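(* Let $G$ be a complex linear algebraic group, let $\lambda\colon G\to\mathrm{GL}(W)$ and $\rho\colon G\to\mathrm{GL}(V)$ be finite-dimensional complex representations, and let $f\colon W\to V$ be a $G$-equivariant algebraic morphism (a polynomial map with $f(\lambda(g)\cdot w)=\rho(g)\cdot f(w)$ for all $g\in G$, $w\in W$). Then for any $w\in W$, \[ \mathrm{diam}_+(V,\mathrm{im}(f))\leq 2\cdot \mathrm{diam}_+^G(V,\mathrm{im}(D_wf)), \] where $D_wf\colon W\to V$ is the derivative (differential) of $f$ at $w$.
   Context: For a subset $X$ of an abelian semigroup $(S,+)$ with zero (here $S=V$), the additive diameter is $\mathrm{diam}_+(S,X)=\min\{d\mid dX=S\}$, where $dX=\{x_1+\cdots+x_d\mid x_i\in X\cup\{0\}\}$. For a group $G$, a finite-dimensional complex representation $\rho\colon G\to\mathrm{GL}(V)$ and a linear subspace $U\leq V$, the $G$-additive diameter of $V$ with respect to $U$ is \[ \mathrm{diam}_+^G(V,U)=\min\{d \mid \rho(g_1)\cdot U+\dots+\rho(g_d)\cdot U=V \text{ for some } g_1,\dots,g_d\in G\}. \] Both diameters are $\infty$ if no such $d$ exists. Representations of linear algebraic groups are algebraic. *)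

(* Defs.v *)
From mathcomp Require Import all_boot all_order all_algebra.
From mathcomp Require Export complex mpoly.
From mathcomp Require Export boolp classical_sets reals constructive_ereal.

Set Implicit Arguments.
Unset Strict Implicit.
Unset Printing Implicit Defensive.

Import Order.TTheory GRing.Theory Num.Theory passmx.

Local Open Scope classical_set_scope.
Local Open Scope ring_scope.

(* Diameters take values in nat extended by +oo, embedded in \bar int so that
   the arithmetic and the order of extended numbers are available. *)
Definition min_or_oo (P : nat -> Prop) : \bar int :=
  match pselect (exists d : nat, `[< P d >]) with
  | left exP => (Posz (ex_minn exP))%:E
  | right _ => +oo%E
  end.

Definition nfold_sumset (S : nmodType) (d : nat) (X : set S) : set S :=
  [set s | exists x : 'I_d -> S,
     (forall i, X (x i) \/ x i = 0) /\ s = \sum_(i < d) x i].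

Definition diam_add (S : nmodType) (X : set S) : \bar int :=
  min_or_oo (fun d => nfold_sumset d X = setT).

Section Groups.
Variables (F : fieldType) (n : nat).
Implicit Types G : set 'M[F]_n.

(* A Zariski closed subgroup of GL_n(F); polynomials on matrices are
   polynomials in the n * n entries, listed by mxvec. *)
Definition linear_algebraic_group G : Prop :=
  [/\ exists I : set {mpoly F[n * n]},
        G = [set A | A \in unitmx /\ forall p, I p -> p.@[mxvec A 0] = 0],
      G 1%:M,
      forall A B, G A -> G B -> G (A *m B)
    & forall A, G A -> G (invmx A)].

(* Restriction to G of an element of the coordinate ring F[x_ij, 1/det] of
   GL_n. *)
Definition regular_on G (phi : 'M[F]_n -> F) : Prop :=
  exists (p : {mpoly F[n * n]}) (k : nat),
    forall A, G A -> phi A = p.@[mxvec A 0] / \det A ^+ k.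

(* Only the values of rho on G matter; there they are invertible, because G is
   closed under inverses. *)
Definition algebraic_rep G (V : vectType F) (rho : 'M[F]_n -> 'End(V)) : Prop :=
  [/\ rho 1%:M = \1%VF,
      forall A B, G A -> G B -> rho (A *m B) = (rho A \o rho B)%VF
    & forall (l : 'Hom(V, F^o)) (v : V), regular_on G (fun A => l (rho A v))].

Definition diam_add_rep G (V : vectType F) (rho : 'M[F]_n -> 'End(V))
    (U : {vspace V}) : \bar int :=
  min_or_oo (fun d => exists g : 'I_d -> 'M[F]_n,
    (forall i, G (g i)) /\ (\sum_(i < d) (rho (g i) @: U))%VS = fullv).

End Groups.

Section PolynomialMaps.
Variables (F : fieldType) (W V : vectType F).

(* Polynomial maps W -> V, given by their coordinate polynomials in the bases
   vbasis of W and V. *)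
Record polymap := PolyMap {
  polymap_coord : 'I_(\dim {:V}) -> {mpoly F[\dim {:W}]} }.

Definition polymap_fun (f : polymap) (w : W) : V :=
  vecof (vbasis {:V})
    (\row_j (polymap_coord f j).@[rVof (vbasis {:W}) w 0]).

(* The linear map given by the Jacobian matrix at w (transposed, since hommx
   acts on row vectors). *)
Definition differential (f : polymap) (w : W) : 'Hom(W, V) :=
  hommx (vbasis {:W}) (vbasis {:V})
    (\matrix_(i, j) ((polymap_coord f j)^`M(i)).@[rVof (vbasis {:W}) w 0]).

End PolynomialMaps.

Coercion polymap_fun : polymap >-> Funclass.

(* Main.v *)
Require Import Defs.
From mathcomp Require Import all_boot all_order all_algebra all_field.
From mathcomp Require Import ring complex mpoly.
From mathcomp Require Import boolp classical_sets reals constructive_ereal.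

(* Suppose that the translates of im(D_w f) by g_1, ..., g_d span V. Then
   F(x_1, ..., x_d) = sum_i rho(g_i) f(x_i), as a map W^d -> V, has a surjective
   differential at (w, ..., w), so its coordinates are algebraically independent.
   The image of F is constructible and lies in no hypersurface, hence contains a
   nonempty Zariski open set; two such sets always add up to the whole space. So
   each v is F(a) + F(b), and by equivariance each rho(g_i) f(x_i) is a value of f. *)

Set Implicit Arguments.
Unset Strict Implicit.
Unset Printing Implicit Defensive.

Import Order.TTheory GRing.Theory Num.Theory passmx.

Local Open Scope classical_set_scope.
Local Open Scope ring_scope.

(** * Nonroots of nonzero polynomials in characteristic zero *)

Lemma poly_exists_nonroot (R : numDomainType) (p : {poly R}) :
  p != 0 -> exists x, p.[x] != 0.
Proof.
(* The candidates 0, 1, 2, ... number one more than the degree and are distinct in characteristic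
   zero. *)
move=> p0; pose rs := [seq i%:R : R | i <- iota 0 (size p)].
have [/allP rsP|/allPn[x _ px]] := boolP (all (root p) rs); last by exists x.
have := max_poly_roots p0 (introT allP rsP); rewrite size_map size_iota ltnn.
suff -> : uniq rs by move/(_ isT).
by rewrite map_inj_uniq ?iota_uniq// => i j /eqP; rewrite eqr_nat => /eqP.
Qed.

(** A monomial is determined by its exponent in the last variable together with its other exponents,
    so [muni] merges no two terms of [p]. *)
Lemma muni_eq0 (R : nzRingType) n (p : {mpoly R[n.+1]}) :
  (muni p == 0) = (p == 0).
Proof.
apply/eqP/eqP => [p0|->]; last exact: raddf0.
apply/mpolyP => m; rewrite mcoeff0; apply/eqP/negPn.
rewrite -[_ != 0]mcoeff_msupp; apply/negP => mp.
have /(congr1 (fun q : {poly {mpoly R[n]}} =>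
   q`_(m ord_max)@_[multinom m (widen_ord (leqnSn n) i) | i < n])) := p0.
rewrite muniE coef_sum raddf_sum /= (big_rem m)//= big_seq big1 => [|m' m'p].
  rewrite coefZ coefXn eqxx mulr1 mcoeffZ mcoeffX eqxx mulr1 addr0 coef0 mcoeff0.
  by apply/eqP; rewrite -mcoeff_msupp.
rewrite coefZ coefXn eq_sym; case: eqVneq => [mE|]; last by rewrite mulr0 mcoeff0.
rewrite mulr1 mcoeffZ mcoeffX; case: eqVneq => [/mnmP m'E|]; last by rewrite mulr0.
suff m'm : m' = m by move: m'p; rewrite m'm mem_rem_uniqF.
apply/mnmP => i; case: (unliftP ord_max i) => [j|] -> //.
have := m'E j; rewrite !mnmE; congr (_ = _); congr (_ _);
  apply/val_inj => /=; by rewrite /bump leqNgt ltn_ord.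
Qed.

Lemma meval_muni (R : comNzRingType) n (p : {mpoly R[n.+1]}) (v : 'I_n -> R) x :
  (map_poly (meval v) (muni p)).[x]
    = p.@[fun i => if unlift ord_max i is Some j then v j else x].
Proof.
rewrite muniE [in RHS](mpolyE p) !raddf_sum /= horner_sum.
apply: eq_bigr => m _.
rewrite map_polyZ /= map_polyXn hornerZ hornerXn !mevalZ -mulrA; congr (_ * _).
rewrite !mevalX big_ord_recr/= unlift_none; congr (_ * _).
apply: eq_bigr => i _; rewrite mnmE.
suff -> : widen_ord (leqnSn n) i = lift ord_max i by rewrite liftK.
by apply/val_inj => /=; rewrite /bump leqNgt ltn_ord.
Qed.

Lemma mpoly_exists_nonroot (R : numDomainType) n (p : {mpoly R[n]}) :
  p != 0 -> exists v, p.@[v] != 0.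
Proof.
elim: n p => [|n IHn] p p0.
  exists (fun=> 0); apply: contraNneq p0 => pv; apply/eqP/mpolyP => m.
  have m0 (m' : 'X_{1.. 0}) : m' = 0%MM by apply/mnmP; case.
  rewrite mcoeff0 (m0 m) -[RHS]pv mevalE.
  rewrite (eq_bigr (fun m' => p@_m' * (m' == 0%MM)%:R)) => [|m' _]; last first.
    by rewrite big_ord0 (m0 m') eqxx.
  rewrite {1}(mpolyE p) raddf_sum/=.
  by apply: eq_bigr => m' _; rewrite mcoeffZ mcoeffX.
(* At a point where the leading coefficient in the last variable does not vanish, specializing the
   other variables leaves a nonzero univariate polynomial. *)
have q0 : lead_coef (muni p) != 0 by rewrite lead_coef_eq0 muni_eq0.
have [v qv] := IHn _ q0.
have /poly_exists_nonroot[x px] : map_poly (meval v) (muni p) != 0.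
  apply: contraNneq qv => /(congr1 (fun q : {poly _} => q`_(size (muni p)).-1)).
  by rewrite coef_map coef0 => ->.
by exists (fun i => if unlift ord_max i is Some j then v j else x);
  rewrite -meval_muni.
Qed.

(** * The chain rule and the Jacobian criterion for algebraic independence *)

Lemma mderivXU (R : nzRingType) n (i j : 'I_n) :
  ('X_j : {mpoly R[n]})^`M(i) = (i == j)%:R.
Proof.
rewrite mderivX mnm1E eq_sym; have [->|ij] := eqVneq i j; last by rewrite scale0r.
by rewrite scale1r -[U_(j)%MM in X in (X - _)%MM]add0m addmK mpolyX0.
Qed.

Lemma mderiv_comp (R : comNzRingType) n k (p : {mpoly R[n]})
    (T : n.-tuple {mpoly R[k]}) i :
  (p \mPo T)^`M(i) = \sum_(j < n) (p^`M(j) \mPo T) * (tnth T j)^`M(i).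
Proof.
(* The chain rule passes to products, so constants and variables yield it for every term [c *:
   'X_[m]]; induction on the terms handles sums. *)
pose chain q := (q \mPo T)^`M(i) = \sum_(j < n) (q^`M(j) \mPo T) * (tnth T j)^`M(i).
have chainM q r : chain q -> chain r -> chain (q * r).
  rewrite /chain => cq cr.
  rewrite rmorphM mderivM cq cr mulr_suml mulr_sumr -big_split /=.
  by apply: eq_bigr => j _; rewrite mderivM rmorphD !rmorphM /=; ring.
have chainC c : chain c%:MP.
  by rewrite /chain comp_mpolyC mderivC big1 // => j _; rewrite mderivC comp_mpoly0 mul0r.
have chainX j : chain 'X_j.
  rewrite /chain comp_mpolyXU -tnth_nth (bigD1 j) //= big1 => [|l lj].
    by rewrite mderivXU eqxx comp_mpoly1 mul1r addr0.
  by rewrite mderivXU (negPf lj) comp_mpoly0 mul0r.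
rewrite -/(chain p); elim/mpolyind: p => [|c m p _ _ chainp]; first exact: chainC 0.
suff : chain (c *: 'X_[m]).
  rewrite /chain => chaincX.
  rewrite comp_mpolyD mderivD chaincX chainp -big_split /=.
  by apply: eq_bigr => j _; rewrite mderivD comp_mpolyD mulrDl.
rewrite -mul_mpolyC mpolyXE_id; apply: (chainM) => //.
apply: (big_ind chain) => [||j _]; [by rewrite -mpolyC1|exact: chainM|].
by elim: (m j) => [|e IHe]; rewrite ?expr0 -?mpolyC1// exprS; apply: (chainM).
Qed.

(** Differentiating in a variable that occurs in a monomial multiplies the coefficient by a positive
    integer, which is nonzero in characteristic zero. *)
Lemma mpoly_mderiv_eq0 (R : numDomainType) n (p : {mpoly R[n]}) :
  (forall i, p^`M(i) = 0) -> p = (p@_0)%:MP.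
Proof.
move=> p'; apply/mpolyP => m; rewrite mcoeffC.
case: eqVneq => [->|m0]; first by rewrite mulr1.
have [i mi] : exists i, m i != 0%N.
  apply/existsP; apply: contraNT m0; rewrite negb_exists => /forallP m0.
  by apply/eqP/mnmP => i; rewrite mnm0E; apply/eqP/negPn.
have /(congr1 (mcoeff (m - U_(i))%MM)) := p' i.
rewrite mcoeff_mderiv mcoeff0 addmC addmBA ?lep1mP// addmC addmK mulr0.
by move/eqP; rewrite mulrn_eq0 => /orP[//|/eqP].
Qed.

(* By the chain rule the partial derivatives of a relation between the T_j are again
   relations, of smaller degree. *)
Lemma jacobian_free_comp_eq0 (F : numFieldType) m N (T : m.-tuple {mpoly F[N]})
    (x : 'I_N -> F) (p : {mpoly F[m]}) :
  row_free (\matrix_(j < m, i < N) ((tnth T j)^`M(i)).@[x]) ->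
  p \mPo T = 0 -> p = 0.
Proof.
move=> /row_freeP[B JB].
pose J : 'M[{mpoly F[N]}]_(m, N) := \matrix_(j, i) (tnth T j)^`M(i).
(* [B] is a right inverse of the Jacobian at [x], so the polynomial [D] takes the value 1 there and
   is nonzero. *)
pose D := \det (J *m map_mx (@mpolyC N F) B).
have D0 : D != 0.
  suff : D.@[x] != 0 by apply: contraNneq => ->; rewrite meval0.
  rewrite -det_map_mx map_mxM -map_mx_comp.
  have -> : map_mx (meval x) J = \matrix_(j, i) ((tnth T j)^`M(i)).@[x].
    by apply/matrixP => j i; rewrite !mxE.
  have -> : map_mx (meval x \o @mpolyC N F) B = B.
    by apply/matrixP => j i; rewrite !mxE /= mevalC.
  by rewrite JB det1 oner_neq0.
have [k] : exists k, forall m', (k <= mdeg m')%N -> p@_m' = 0.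
  by exists (msize p) => m' /msize_mdeg_ge/memN_msupp_eq0.
elim: k p => [|k IHk] q szq qT.
  by apply/mpolyP => m'; rewrite mcoeff0 szq.
(* By the chain rule [J] kills the row [r]; multiplying further by [B] and the adjugate shows that
   [D] times [r] is zero, and [D] cancels. *)
have q'T j : q^`M(j) \mPo T = 0.
  pose r := \row_j (q^`M(j) \mPo T).
  have rJ : r *m J = 0.
    apply/rowP => i; rewrite mxE [RHS]mxE.
    transitivity ((q \mPo T)^`M(i)); last by rewrite qT mderiv0.
    by rewrite mderiv_comp; apply: eq_bigr => l _; rewrite !mxE.
  have : r *m (J *m map_mx (@mpolyC N F) B) *m \adj (J *m map_mx (@mpolyC N F) B) = 0.
    by rewrite mulmxA rJ !mul0mx.
  rewrite -mulmxA mul_mx_adj mul_mx_scalar => /rowP/(_ j).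
  by rewrite !mxE => /eqP; rewrite mulf_eq0 (negPf D0) => /eqP.
have q' j : q^`M(j) = 0.
  apply: IHk (q'T j) => m' km'.
  by rewrite mcoeff_mderiv szq ?mul0rn// mdegD mdeg1 addn1.
move: qT; rewrite (mpoly_mderiv_eq0 q') comp_mpolyC => /eqP.
by rewrite mpolyC_eq0 => /eqP ->.
Qed.

(** * Images of polynomial maps through first-order formulas *)

(** The shift [k] keeps the variables below [k] free for the coordinates of a target point. *)
Definition term_of_mpoly (F : fieldType) N (k : nat) (p : {mpoly F[N]}) : GRing.term F :=
  \big[GRing.Add/GRing.Const 0]_(m <- msupp p)
    GRing.Mul (GRing.Const p@_m)
      (\big[GRing.Mul/GRing.Const 1]_(i < N) GRing.Exp (GRing.Var F (k + i)) (m i)).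

Lemma eval_term_of_mpoly (F : fieldType) N k (p : {mpoly F[N]}) e :
  GRing.eval e (term_of_mpoly k p) = p.@[fun i => e`_(k + i)].
Proof.
rewrite mevalE [LHS](big_morph (GRing.eval e) (id1 := 0) (op1 := +%R))//.
apply: eq_bigr => m _ /=; congr (_ * _).
by rewrite (big_morph (GRing.eval e) (id1 := 1) (op1 := *%R)).
Qed.

Lemma rterm_term_of_mpoly (F : fieldType) N k (p : {mpoly F[N]}) :
  GRing.rterm (term_of_mpoly k p).
Proof.
apply: (big_ind (@GRing.rterm F)) => //= [t u -> -> //|m _].
by apply: (big_ind (@GRing.rterm F)) => //= t u -> ->.
Qed.

Lemma holds_bigAnd (F : fieldType) (I : finType) (P : I -> GRing.formula F) e :
  GRing.holds e (\big[GRing.And/GRing.Bool true]_i P i)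
    <-> forall i, GRing.holds e (P i).
Proof.
suff bigAnd s : GRing.holds e (\big[GRing.And/GRing.Bool true]_(i <- s) P i)
    <-> forall i, i \in s -> GRing.holds e (P i).
  by split=> [/bigAnd eP i|eP]; [apply: eP; rewrite mem_index_enum|exact/bigAnd].
elim: s => [|i s IHs]; rewrite ?big_nil ?big_cons //=; split.
  by move=> [ePi /IHs ePs] k; rewrite inE => /predU1P[->|/ePs].
by move=> eP; split; [|apply/IHs => k ks]; apply: eP; rewrite inE ?eqxx// ks orbT.
Qed.

Lemma mpoly_of_rterm (F : fieldType) m (t : GRing.term F) : GRing.rterm t ->
  exists p : {mpoly F[m]}, forall v, GRing.eval (mkseq v m) t = p.@[v \o val].
Proof.
elim: t => //=.
- move=> k _; have [km|mk] := ltnP k m; last first.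
    (* Variables beyond the listed values evaluate to the default 0. *)
    by exists 0 => v; rewrite nth_default ?size_mkseq// meval0.
  by exists 'X_(Ordinal km) => v; rewrite nth_mkseq// mevalXU.
- by move=> c _; exists c%:MP => v; rewrite mevalC.
- by move=> n _; exists n%:R => v; rewrite rmorph_nat.
- move=> t IHt u IHu /andP[/IHt[p pE] /IHu[q qE]].
  by exists (p + q) => v; rewrite pE qE mevalD.
- by move=> t IHt /IHt[p pE]; exists (- p) => v; rewrite pE mevalN.
- by move=> t IHt n /IHt[p pE]; exists (p *+ n) => v; rewrite pE mevalMn.
- move=> t IHt u IHu /andP[/IHt[p pE] /IHu[q qE]].
  by exists (p * q) => v; rewrite pE qE mevalM.
- by move=> t IHt n /IHt[p pE]; exists (p ^+ n) => v; rewrite pE rmorphXn.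
Qed.

(* For a constructible set, either it or its complement contains a nonempty Zariski
   open set. *)
Lemma qf_eval_generic (F : fieldType) m (f : GRing.formula F) :
  GRing.qf_form f -> GRing.rformula f ->
  exists (h : {mpoly F[m]}) (b : bool), h != 0 /\
    forall v, h.@[v \o val] != 0 -> GRing.qf_eval (mkseq v m) f = b.
Proof.
have bin (f1 f2 : GRing.formula F) (op : bool -> bool -> bool) :
    (exists (h : {mpoly F[m]}) (b : bool), h != 0 /\
      forall v, h.@[v \o val] != 0 -> GRing.qf_eval (mkseq v m) f1 = b) ->
    (exists (h : {mpoly F[m]}) (b : bool), h != 0 /\
      forall v, h.@[v \o val] != 0 -> GRing.qf_eval (mkseq v m) f2 = b) ->
    exists (h : {mpoly F[m]}) (b : bool), h != 0 /\
      forall v, h.@[v \o val] != 0 ->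
        op (GRing.qf_eval (mkseq v m) f1) (GRing.qf_eval (mkseq v m) f2) = b.
  move=> [h1 [b1 [h10 fE1]]] [h2 [b2 [h20 fE2]]].
  exists (h1 * h2), (op b1 b2); rewrite mulf_neq0//; split=> // v.
  by rewrite mevalM mulf_eq0 negb_or => /andP[/fE1-> /fE2->].
elim: f => //=.
- by move=> b _ _; exists 1, b; rewrite oner_neq0.
- move=> t u _ /andP[/(@mpoly_of_rterm _ m)[p pE] /(@mpoly_of_rterm _ m)[q qE]].
  (* An equation between distinct polynomials is false off the zero set of their difference. *)
  have [pq|pq] := eqVneq p q.
    by exists 1, true; rewrite oner_neq0; split=> // v _; rewrite pE qE pq eqxx.
  exists (p - q), false; rewrite subr_eq0 pq; split=> // v.
  by rewrite mevalB subr_eq0 -pE -qE => /negPf.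
- by move=> f1 I1 f2 I2 /andP[/I1{}I1 /I2{}I2] /andP[/I1{}I1 /I2{}I2]; apply: bin.
- by move=> f1 I1 f2 I2 /andP[/I1{}I1 /I2{}I2] /andP[/I1{}I1 /I2{}I2]; apply: bin.
- by move=> f1 I1 f2 I2 /andP[/I1{}I1 /I2{}I2] /andP[/I1{}I1 /I2{}I2]; apply: bin.
- move=> f IHf /IHf{}IHf /IHf[h [b [h0 fE]]].
  by exists h, (~~ b); split=> // v /fE->.
Qed.

(* Quantifier elimination plays the role of Chevalley's theorem: the image of T is
   the set of points satisfying a quantifier-free formula. *)
Lemma dominant_image_generic (F : closedFieldType) m N (T : m.-tuple {mpoly F[N]}) :
  (forall h, (forall x, (h \mPo T).@[x] = 0) -> h = 0) ->
  exists2 h : {mpoly F[m]}, h != 0 &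
    forall y, h.@[y] != 0 -> exists x, forall j, (tnth T j).@[x] = y j.
Proof.
move=> Tdom.
(* Variables below [m] are the free coordinates of the target; the next [N] are the quantified
   coordinates of the source. *)
pose f := foldr GRing.Exists (\big[GRing.And/GRing.Bool true]_(j < m)
   GRing.Equal (term_of_mpoly m (tnth T j)) (GRing.Var F j)) (iota m N).
have rf : GRing.rformula f.
  rewrite /f; elim: iota => //=.
  apply: (big_ind (@GRing.rformula F)) => //= [g1 g2 -> -> //|j _].
  by rewrite rterm_term_of_mpoly.
have holdsf (v : nat -> F) : GRing.holds (mkseq v m) f <->
    exists x, forall j, (tnth T j).@[x] = v j.
  rewrite /f; split=> [/GRing.foldExistsP[e ev]|[x xv]].
    move=> /holds_bigAnd fe; exists (fun i => e`_(m + i)) => j.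
    have := fe j; rewrite /= eval_term_of_mpoly => ->.
    by rewrite -ev ?nth_mkseq// !inE mem_iota leqNgt ltn_ord.
  pose x' i := if insub i is Some j then x j else 0.
  pose e := mkseq v m ++ mkseq x' N.
  have ex : (fun i : 'I_N => e`_(m + i)) =1 x.
    move=> i; rewrite /e nth_cat size_mkseq addKn ltnNge leq_addr /= nth_mkseq//.
    by rewrite /x' (valK i).
  apply/GRing.foldExistsP; exists e => [i|].
    rewrite !inE mem_iota negb_and -ltnNge -leqNgt /e nth_cat size_mkseq.
    case: ltnP => //= mi mNi.
    by rewrite !nth_default// size_mkseq// -(leq_add2l m) subnKC.
  apply/holds_bigAnd => j; rewrite /= eval_term_of_mpoly (meval_eq _ ex) xv.
  by rewrite /e nth_cat size_mkseq ltn_ord nth_mkseq.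
have qwf := GRing.quantifier_elim_wf (@ClosedFieldQE.wf_ex_elim F) rf.
have qP e := GRing.quantifier_elim_rformP (@ClosedFieldQE.wf_ex_elim F)
  (ClosedFieldQE.holds_ex_elim (@GRing.solve_monicpoly F)) e rf.
set q := GRing.quantifier_elim _ f in qwf qP.
have /andP[qf qr] := qwf.
have [h [[] [h0 hq]]] := qf_eval_generic m qf qr.
  exists h => // y hy.
  pose v i := if insub i is Some j then y j else 0.
  have vy : v \o val =1 y by move=> j; rewrite /v /= (valK j).
  have /hq/qP/holdsf[x xv] : h.@[v \o val] != 0 by rewrite (meval_eq _ vy).
  by exists x => j; rewrite xv -[RHS]vy.
(* If the formula is generically false, then [h] vanishes on the whole image of [T], hence is zero
   by dominance. *)
case/eqP: h0; apply: Tdom => x; rewrite comp_mpoly_meval; apply/eqP.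
pose v i := if insub i is Some j then (tnth T j).@[x] else 0.
have vT : v \o val =1 (fun j => (tnth T j).@[x]) by move=> j; rewrite /v /= (valK j).
rewrite -(meval_eq _ vT); apply/negP => /negP /hq /qP; apply.
by apply/holdsf; exists x => j; rewrite -vT.
Qed.

(** * Sums of two generic points *)

(** The substitution of [v - u] for [u] is an involution, so it keeps [h] nonzero; any nonroot of
    the product of [h] and its substitute serves as [u]. *)
Lemma generic_add_generic (R : numDomainType) n (h : {mpoly R[n]}) (v : 'I_n -> R) :
  h != 0 -> exists2 u, h.@[u] != 0 & h.@[fun i => v i - u i] != 0.
Proof.
move=> h0; pose T := [tuple (v i)%:MP - 'X_i | i < n].
have TE u : (h \mPo T).@[u] = h.@[fun i => v i - u i].
  rewrite comp_mpoly_meval; apply: meval_eq => i.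
  by rewrite tnth_mktuple mevalB mevalC mevalXU.
have hT0 : h \mPo T != 0.
  have [u hu] := mpoly_exists_nonroot h0.
  apply: contraNneq hu => hT; have := TE (fun i => v i - u i).
  rewrite hT meval0 => ->; apply/eqP/meval_eq => i.
  by rewrite opprB addrCA subrr addr0.
have [u] := mpoly_exists_nonroot (mulf_neq0 h0 hT0).
by rewrite mevalM mulf_eq0 negb_or TE => /andP[hu hvu]; exists u.
Qed.

Lemma jacobian_free_image_add (F : numClosedFieldType) m N
    (T : m.-tuple {mpoly F[N]}) (x : 'I_N -> F) :
  row_free (\matrix_(j < m, i < N) ((tnth T j)^`M(i)).@[x]) ->
  forall v : 'I_m -> F,
    exists a b, forall j, v j = (tnth T j).@[a] + (tnth T j).@[b].
Proof.
move=> Jfree v.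
have [h h0 himg] : exists2 h : {mpoly F[m]}, h != 0 &
    forall y, h.@[y] != 0 -> exists x, forall j, (tnth T j).@[x] = y j.
  apply: dominant_image_generic => h hT.
  (* A composite that vanishes at every point is the zero polynomial. *)
  apply: (jacobian_free_comp_eq0 Jfree); apply/eqP; apply: contraT.
  by move=> /mpoly_exists_nonroot[y]; rewrite hT eqxx.
have [u /himg[a aE] /himg[b bE]] := generic_add_generic v h0.
by exists a, b => j; rewrite aE bE addrC subrK.
Qed.

Lemma mxvec_index_eq m n (i i' : 'I_m) (j j' : 'I_n) :
  (mxvec_index i j == mxvec_index i' j') = (i == i') && (j == j').
Proof.
have := mxvecE (delta_mx i' j' : 'M[int]_(m, n)) i j.
by rewrite mxvec_delta !mxE eqxx /=; case: (_ == _); case: (_ && _).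
Qed.

(** * The sum of translates in coordinates *)

Section SumOfTranslates.
Variables (F : numClosedFieldType) (W V : vectType F) (d : nat).
Variables (A : 'I_d -> 'End(V)) (f : polymap W V) (w : W).
Local Notation N := (\dim {:W}).
Local Notation m := (\dim {:V}).
Local Notation eV := (vbasis {:V}).
Local Notation eW := (vbasis {:W}).

(** The coordinates on the [i]-th factor of W^d, with pairs (factor, coordinate) flattened as the
    entries of a d by N matrix. *)
Definition block_vars (i : 'I_d) : N.-tuple {mpoly F[d * N]} :=
  [tuple 'X_(mxvec_index i a) | a < N].

(** Coordinates of the map sending (x_1, ..., x_d) to the sum of the A_i f(x_i); matrices act on row
    vectors, hence the index order [k j]. *)
Definition translate_sum : m.-tuple {mpoly F[d * N]} :=
  [tuple \sum_i \sum_k mxof eV eV (A i) k j *: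
     (polymap_coord f k \mPo block_vars i) | j < m].

Lemma meval_translate_sum (x : 'I_(d * N) -> F) j :
  (tnth translate_sum j).@[x] =
    rVof eV (\sum_i A i (f (vecof eW (\row_a x (mxvec_index i a))))) 0 j.
Proof.
rewrite tnth_mktuple !linear_sum /= summxE; apply: eq_bigr => i _.
rewrite (rVof_app _ (vbasisP _)) mxE linear_sum; apply: eq_bigr => k _.
rewrite /= mevalZ mulrC; congr (_ * _).
rewrite /polymap_fun vecofK ?vbasisP// mxE vecofK ?vbasisP// comp_mpoly_meval.
by apply: meval_eq => a; rewrite tnth_mktuple mevalXU mxE.
Qed.

(** Only the [i]-th summand involves the variables of block [i], and there the chain rule gives D_w
    f followed by A_i. *)
Lemma mderiv_translate_sum (x : 'I_(d * N) -> F) i a j :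
  (forall a, x (mxvec_index i a) = rVof eW w 0 a) ->
  ((tnth translate_sum j)^`M(mxvec_index i a)).@[x]
    = (mxof eW eV (differential f w) *m mxof eV eV (A i)) a j.
Proof.
move=> xw; rewrite tnth_mktuple (linear_sum (mderiv _)) (linear_sum (meval _)).
rewrite (bigD1 i)//= [X in _ + X]big1 ?addr0 => [|i' i'i]; last first.
  rewrite /= (linear_sum (mderiv _)) (linear_sum (meval _)) big1//= => k _.
  rewrite mderivZ mderiv_comp.
  rewrite big1 ?scaler0 ?meval0// => b _.
  by rewrite tnth_mktuple mderivXU mxvec_index_eq eq_sym (negPf i'i) mulr0.
rewrite (linear_sum (mderiv _)) (linear_sum (meval _)) mxE.
apply: eq_bigr => k _ /=.
rewrite mderivZ mevalZ mulrC /differential hommxK ?mxE ?vbasisP//.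
congr (_ * _); rewrite mderiv_comp (bigD1 a)//= big1 ?addr0 => [|b ba].
  rewrite tnth_mktuple mderivXU eqxx mulr1 comp_mpoly_meval.
  by apply: meval_eq => b; rewrite tnth_mktuple mevalXU.
by rewrite tnth_mktuple mderivXU mxvec_index_eq eqxx eq_sym (negPf ba) mulr0.
Qed.

Lemma sum_translates_image_add :
  (\sum_(i < d) (A i @: limg (differential f w)))%VS = fullv ->
  forall v : V, exists a b : 'I_d -> W,
    v = \sum_i A i (f (a i)) + \sum_i A i (f (b i)).
Proof.
move=> AD v; pose x := mxvec (\matrix_(i < d, a < N) rVof eW w 0 a) 0.
have xw i a : x (mxvec_index i a) = rVof eW w 0 a by rewrite /x mxvecE mxE.
have Jfree : row_free (\matrix_(j < m, i < d * N) ((tnth translate_sum j)^`M(i)).@[x]).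
  (* A row [c] in the left kernel is a linear form on V that vanishes on each A_i(im D_w f), hence
     on their sum V, so [c] is zero. *)
  apply: inj_row_free => c cJ.
  have cA i : mxof eW eV (differential f w) *m mxof eV eV (A i) *m c^T = 0.
    apply/colP => a; move/rowP/(_ (mxvec_index i a)): cJ; rewrite !mxE => cJ.
    rewrite -[RHS]cJ; apply: eq_bigr => j _.
    by rewrite [in RHS]mxE mderiv_translate_sum// mulrC !mxE.
  have cV u : rVof eV u *m c^T = 0.
    have : u \in (\sum_(i < d) (A i @: limg (differential f w)))%VS by rewrite AD memvf.
    move=> /memv_sumP[us usP ->]; rewrite linear_sum mulmx_suml big1// => i _ /=.
    have /memv_imgP[u1 /memv_imgP[u2 _ ->] ->] := usP i isT.
    rewrite (rVof_app _ (vbasisP _)) (rVof_app _ (vbasisP _)).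
    by rewrite -2!mulmxA (mulmxA (mxof eW eV _)) cA mulmx0.
  apply/rowP => j; have := cV (vecof eV (delta_mx 0 j)).
  by rewrite vecofK ?vbasisP// -rowE => /rowP/(_ 0); rewrite !mxE.
have [a [b vE]] := jacobian_free_image_add Jfree (rVof eV v 0).
exists (fun i => vecof eW (\row_k a (mxvec_index i k))).
exists (fun i => vecof eW (\row_k b (mxvec_index i k))).
rewrite -[LHS](rVofK (vbasisP _)) -[RHS](rVofK (vbasisP _)); congr vecof.
by apply/rowP => j; rewrite vE !meval_translate_sum linearD [RHS]mxE.
Qed.

End SumOfTranslates.

(** * Comparison of the two diameters *)

Lemma min_or_oo_le (P : nat -> Prop) d : P d -> (min_or_oo P <= d%:Z%:E)%E.
Proof.
move=> Pd; rewrite /min_or_oo; case: pselect => [exP|[]]; last by exists d; apply/asboolP.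
by case: ex_minnP => k _ kmin; rewrite lee_fin lez_nat kmin//; apply/asboolP.
Qed.

Lemma min_or_ooP (P : nat -> Prop) :
  min_or_oo P = +oo%E \/ exists2 d, P d & min_or_oo P = d%:Z%:E.
Proof.
rewrite /min_or_oo; case: pselect => [exP|_]; last by left.
by right; case: ex_minnP => k /asboolP Pk _; exists k.
Qed.

Theorem theorem1p8 (R : realType) (n : nat) (G : set 'M[R[i]]_n)
    (hG : linear_algebraic_group G)
    (W V : vectType R[i])
    (lambda : 'M[R[i]]_n -> 'End(W)) (rho : 'M[R[i]]_n -> 'End(V))
    (hlambda : algebraic_rep G lambda) (hrho : algebraic_rep G rho)
    (f : polymap W V)
    (hf : forall (g : 'M[R[i]]_n) (w : W),
        G g -> f (lambda g w) = rho g (f w))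
    (w : W) :
  (diam_add (range f) <= 2%:E * diam_add_rep G rho (limg (differential f w)))%E.
Proof.
rewrite /diam_add_rep; set P := (P in min_or_oo P).
have [->|[d [g [Gg gD]] ->]] := min_or_ooP P.
  (* When no translates span V, the right-hand side is infinite. *)
  by rewrite gt0_muley ?lte_fin// leey.
have -> : (2%:E * d%:Z%:E = (d + d)%:Z%:E :> \bar int)%E.
  by rewrite -EFinM PoszD -mulr2n mulr_natl.
apply: min_or_oo_le; apply/seteqP; split=> // v _.
have [a [b ->]] := sum_translates_image_add gD v.
(* The first [d] summands come from [a], the last [d] from [b]; equivariance moves each [rho (g k)]
   inside [f]. *)
exists (fun i => match split i with
  | inl k => f (lambda (g k) (a k)) | inr k => f (lambda (g k) (b k)) end).
split=> [i|]; first by left; case: split => k; eexists.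
rewrite big_split_ord; congr (_ + _); apply: eq_bigr => i _;
  by rewrite ?(unsplitK (inl _)) ?(unsplitK (inr _)) hf.
Qed.
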